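(* Let $\mathcal X\subseteq\mathbb R^d$ be contained in the closure of its interior, let $\|\cdot\|_{\mathcal X}$ be a norm on $\mathbb R^d$, let $s\in\mathbb N$, and let $K\in\mathcal C^{s,s}(\mathcal X\times\mathcal X,\mathbb R^{Q\times Q})$ be a matrix-valued kernel with vector-valued RKHS $\mathcal F_K$. Let $\mathscr K\subseteq\mathcal X$ be compact, $P\ge1$, $\mathbf f_0\in\mathcal F_K$, $\mathbf b_0\in\mathbb R^P$, $\boldsymbol\Gamma\in\mathbb R^{P\times B}$, and let $\mathbf D=[D_{p_1,p_2}]_{p_1,p_2\in[P]}$ with $D_{p_1,p_2}\in O_{Q,s}$ be such that $\mathbf D(\mathbf f)(\mathbf x)=[D_{p_1,p_2}(\mathbf f)(\mathbf x)]_{p_1,p_2\in[P]}$ is a symmetric matrix for all $\mathbf f\in\mathcal F_K,\mathbf x\in\mathcal X$. Assume that the points $\{\tilde{\mathbf x}_m\}_{m\in[M]}\subset\mathcal X$ associated with radii $\delta_m>0$ form a ball-covering of $\mathscr K$, i.e. $\mathscr K\subseteq\bigcup_{m\in[M]}\mathbb B_{\mathcal X}(\tilde{\mathbf x}_m,\delta_m)$. Let $$\eta_{m,P}:=\sup_{\substack{\mathbf x\in\mathbb B_{\mathcal X}(\tilde{\mathbf x}_m,\delta_m),\\ \mathbf u=[u_p]_{p\in[P]}\in\mathscr S^{P-1}}}\Big\|\sum_{p_1,p_2\in[P]}u_{p_1}u_{p_2}\big[D_{p_1,p_2}K(\cdot,\tilde{\mathbf x}_m)-D_{p_1,p_2}K(\cdot,\mathbf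 x)\big]\Big\|_K,$$ $$C_{P,\mathrm{SOC}}:=\big\{(\mathbf f,\mathbf b)\in\mathcal F_K\times\mathbb R^B:\ \eta_{m,P}\|\mathbf f-\mathbf f_0\|_K\,\mathbf I_P\preccurlyeq\mathbf D(\mathbf f-\mathbf f_0)(\tilde{\mathbf x}_m)+\operatorname{diag}(\boldsymbol\Gamma\mathbf b-\mathbf b_0)\ \ \forall m\in[M]\big\},$$ $$C_P:=\big\{(\mathbf f,\mathbf b)\in\mathcal F_K\times\mathbb R^B:\ \mathbf 0_{P\times P}\preccurlyeq\mathbf D(\mathbf f-\mathbf f_0)(\mathbf x)+\operatorname{diag}(\boldsymbol\Gamma\mathbf b-\mathbf b_0)\ \ \forall\mathbf x\in\mathscr K\big\}.$$ Then $C_{P,\mathrm{SOC}}\subseteq C_P$.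
   Context: $[n]=\{1,\dots,n\}$; $\mathscr S^{P-1}$ is the Euclidean unit sphere of $\mathbb R^P$; $\mathbf I_P$ the identity matrix; $\preccurlyeq$ the Loewner (positive semidefinite) order; $\operatorname{diag}(\mathbf v)$ the diagonal matrix with diagonal $\mathbf v$; $\mathbb B_{\mathcal X}(\mathbf c,r)=\{\mathbf x\in\mathcal X:\|\mathbf x-\mathbf c\|_{\mathcal X}\le r\}$. Matrix-valued kernel: $K(\mathbf x,\mathbf x')=K(\mathbf x',\mathbf x)^\top$ and $\sum_{i,j}\mathbf v_i^\top K(\mathbf x_i,\mathbf x_j)\mathbf v_j\ge0$ for all finite families. $\mathcal F_K$ (inner product $\langle\cdot,\cdot\rangle_K$, norm $\|\cdot\|_K$) is the Hilbert space of functions $\mathcal X\to\mathbb R^Q$ containing all $K(\cdot,\mathbf x)\mathbf c$ with $\langle\mathbf f,K(\cdot,\mathbf x)\mathbf c\rangle_K=\langle\mathbf f(\mathbf x),\mathbf c\rangle$. $\mathcal C^{s,s}(\mathcal X\times\mathcal X,\mathbb R^{Q\times Q})$: functions for which $\partial^{\mathbf r,\mathbf r}$ (order $\mathbf r$ in each of the two arguments) exists and is continuous for all multi-indices $|\mathbf r|\le s$ (derivatives at non-interior points are continuous extensions from the interior). $O_{1,s}$: operators $f\mapsto\sum_{j\in J}c_j\partial^{\mathbf r_j}f$, $J$ finite, $|\mathbf r_j|\le s$, $c_j\in\mathbb R$. $O_{Q,s}$: operators $D(\mathbf f)(\mathbf x)=\sum_{q\in[Q]}\beta_qD_q(f_q)(\mathbf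 x)$, $\beta_q\in\mathbb R$, $D_q\in O_{1,s}$. For such $D$, $DK(\mathbf x',\mathbf x):=\sum_q\beta_q\,D_q[\mathbf x''\mapsto K(\mathbf x',\mathbf x'')](\mathbf x)\,\mathbf e_q\in\mathbb R^Q$; under these assumptions every $\mathbf f\in\mathcal F_K$ is $\mathcal C^s$, $DK(\cdot,\mathbf x)\in\mathcal F_K$, and $D(\mathbf f)(\mathbf x)=\langle\mathbf f,DK(\cdot,\mathbf x)\rangle_K$. *)

(* Defs.v *)
From mathcomp Require Import all_boot all_order all_algebra.
From mathcomp Require Import all_classical all_reals all_analysis.

Set Implicit Arguments.
Unset Strict Implicit.
Unset Printing Implicit Defensive.

Import Order.TTheory GRing.Theory Num.Theory.
Import numFieldNormedType.Exports.

Local Open Scope classical_set_scope.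
Local Open Scope ring_scope.

(* Functions on a subset [X] of R^d have type [X -> _], where [X] is coerced to
   the subtype [set_type X] with its induced topology. *)

Section Euclidean.
Context {R : realType}.

Definition dotv n (u v : 'cV[R]_n) : R := (u^T *m v) 0 0.

Definition enorm n (u : 'cV[R]_n) : R := Num.sqrt (dotv u u).

Definition usphere n : set 'cV[R]_n := [set u | enorm u = 1].

Definition psd n (A : 'M[R]_n) : Prop :=
  A^T = A /\ forall v : 'cV[R]_n, 0 <= dotv v (A *m v).

Definition loewner n (A B : 'M[R]_n) : Prop := psd (B - A).

Definition is_norm d (N : 'rV[R]_d -> R) : Prop :=
  [/\ forall x, 0 <= N x,
      forall x, N x = 0 -> x = 0,
      forall (a : R) x, N (a *: x) = `|a| * N x
    & forall x y, N (x + y) <= N x + N y].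

Definition ballX d (X : set 'rV[R]_d) (N : 'rV[R]_d -> R) (c : X) (r : R) :
  set X := [set x : X | N (val x - val c) <= r].

End Euclidean.

Section Derivatives.
Context {R : realType}.

Definition multi_index n := {ffun 'I_n -> nat}.

Definition mi_size n (r : multi_index n) : nat := \sum_(i < n) r i.

(* [r] as a list of directions: 0 repeated r_0 times, 1 repeated r_1 times, ... *)
Definition mi_word n (r : multi_index n) : seq 'I_n :=
  flatten [seq nseq (r i) i | i <- enum 'I_n].

(* the head of the list is the outermost derivative *)
Fixpoint iterD n (w : seq 'I_n) (g : 'rV[R]_n -> R) : 'rV[R]_n -> R :=
  if w is i :: w' then 'D_(delta_mx 0 i) (iterD w' g) else g.

Fixpoint iter_derivable n (U : set 'rV[R]_n) (w : seq 'I_n)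
    (g : 'rV[R]_n -> R) : Prop :=
  if w is i :: w' then
    iter_derivable U w' g /\
    forall x, U x -> derivable (iterD w' g) x (delta_mx 0 i)
  else True.

Section OnSubset.
Context {n : nat} (A : set 'rV[R]_n).

(* [f] extended by 0 outside [A]; only its values near interior points of [A]
   are used below. *)
Definition ext0 (f : A -> R) : 'rV[R]_n -> R := 'valL_ (0 : R) f.

(* At the points of [A] that are not interior, the value is the limit of the
   values at interior points (a dummy if that limit does not exist). *)
Definition partial (r : multi_index n) (f : A -> R) (x : A) : R :=
  let g := iterD (mi_word r) (ext0 f) in
  if `[< A° (val x) >] then g (val x)
  else lim (g @ within A° (nbhs (val x))).

(* When [A] is contained in the closure of [A°], continuity of [partial r f]
   on [A] forces the limits in its definition to exist. *)
Definition partial_exists_continuous (r : multi_index n) (f : A -> R) : Prop :=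
  iter_derivable A° (mi_word r) (ext0 f) /\ continuous (partial r f).

End OnSubset.

(* X x X as a subset of R^(d + d) *)
Definition sqset d (X : set 'rV[R]_d) : set 'rV[R]_(d + d) :=
  [set z | X (lsubmx z) /\ X (rsubmx z)].

Definition sq_fst d (X : set 'rV[R]_d) (z : sqset X) : X :=
  SigSub (mem_set (set_mem (valP z)).1).

Definition sq_snd d (X : set 'rV[R]_d) (z : sqset X) : X :=
  SigSub (mem_set (set_mem (valP z)).2).

(* the multi-index (r, r) *)
Definition mi_double d (r : multi_index d) : multi_index (d + d) :=
  [ffun k : 'I_(d + d) => match fintype.split k with inl i => r i | inr i => r i end].

Definition Css d Q (s : nat) (X : set 'rV[R]_d) (K : X -> X -> 'M[R]_Q) : Prop :=
  forall (r : multi_index d), (mi_size r <= s)%N -> forall i j : 'I_Q,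
    partial_exists_continuous (mi_double r)
      (fun z : sqset X => K (sq_fst z) (sq_snd z) i j).

(* O_{1,s}: the terms are the pairs (c_j, r_j) *)
Record diffop1 (d s : nat) := DiffOp1 {
  terms : seq (R * multi_index d);
  terms_order : all (fun t => (mi_size t.2 <= s)%N) terms }.

Definition app1 d s (X : set 'rV[R]_d) (D : diffop1 d s) (f : X -> R) (x : X) : R :=
  \sum_(t <- terms D) t.1 * partial t.2 f x.

(* O_{Q,s} *)
Record diffop (Q d s : nat) := DiffOp {
  coef : 'I_Q -> R;
  comp_op : 'I_Q -> diffop1 d s }.

Definition appQ Q d s (X : set 'rV[R]_d) (D : diffop Q d s)
    (f : X -> 'cV[R]_Q) (x : X) : R :=
  \sum_q coef D q * app1 (comp_op D q) (fun y => f y q 0) x.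

(* [D_q] acts entrywise on the matrix-valued function [K x']. *)
Definition appK Q d s (X : set 'rV[R]_d) (D : diffop Q d s)
    (K : X -> X -> 'M[R]_Q) (x' x : X) : 'cV[R]_Q :=
  \sum_q coef D q *:
    ((\matrix_(i, j) app1 (comp_op D q) (fun x'' => K x' x'' i j) x) *m
     (delta_mx q 0 : 'cV[R]_Q)).

Definition appMx P Q d s (X : set 'rV[R]_d) (D : 'I_P -> 'I_P -> diffop Q d s)
    (f : X -> 'cV[R]_Q) (x : X) : 'M[R]_P :=
  \matrix_(p1, p2) appQ (D p1 p2) f x.

End Derivatives.

Arguments diffop1 : clear implicits.
Arguments diffop : clear implicits.

Section RKHS.
Context {R : realType} {d Q : nat} {X : set 'rV[R]_d}.

Definition mx_kernel (K : X -> X -> 'M[R]_Q) : Prop :=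
  (forall x x', K x x' = (K x' x)^T) /\
  (forall (n : nat) (x : 'I_n -> X) (v : 'I_n -> 'cV[R]_Q),
     0 <= \sum_i \sum_j dotv (v i) (K (x i) (x j) *m v j)).

(* The inner product is a total function; it is only meaningful on [carrier]. *)
Record rkhs (K : X -> X -> 'M[R]_Q) := Rkhs {
  carrier : set (X -> 'cV[R]_Q);
  ip : (X -> 'cV[R]_Q) -> (X -> 'cV[R]_Q) -> R;
  normH := fun f => Num.sqrt (ip f f);
  carrier0 : carrier 0;
  carrierD : forall f g, carrier f -> carrier g -> carrier (f + g);
  carrierZ : forall (a : R) f, carrier f -> carrier (a *: f);
  ipC : forall f g, carrier f -> carrier g -> ip f g = ip g f;
  ipDl : forall f g h, carrier f -> carrier g -> carrier h ->
    ip (f + g) h = ip f h + ip g h;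
  ipZl : forall (a : R) f g, carrier f -> carrier g ->
    ip (a *: f) g = a * ip f g;
  ip_ge0 : forall f, carrier f -> 0 <= ip f f;
  ip_eq0 : forall f, carrier f -> ip f f = 0 -> f = 0;
  carrier_complete : forall u : nat -> X -> 'cV[R]_Q,
    (forall n, carrier (u n)) ->
    (forall e : R, 0 < e -> exists n0, forall m n, (n0 <= m)%N -> (n0 <= n)%N ->
       normH (u m - u n) < e) ->
    exists2 f, carrier f & (fun n => normH (u n - f)) @ \oo --> (0 : R);
  carrierK : forall x (c : 'cV[R]_Q), carrier (fun x' => K x' x *m c);
  ip_reproducing : forall f x (c : 'cV[R]_Q), carrier f ->
    ip f (fun x' => K x' x *m c) = dotv (f x) c }.

End RKHS.

Section Constraints.
Context {R : realType} {d Q s P B : nat} {X : set 'rV[R]_d}.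
Context {K : X -> X -> 'M[R]_Q}.
Variables (H : rkhs K) (D : 'I_P -> 'I_P -> diffop R Q d s).

Definition eta (N : 'rV[R]_d -> R) (c : X) (r : R) : \bar R :=
  ereal_sup [set (normH H (fun x' => \sum_p1 \sum_p2
      (u p1 0 * u p2 0) *: (appK (D p1 p2) K x' c - appK (D p1 p2) K x' x)))%:E
    | x in ballX N c r & u in @usphere R P].

Variables (f0 : X -> 'cV[R]_Q) (b0 : 'cV[R]_P) (Gamma : 'M[R]_(P, B)).

Definition affine_mx (f : X -> 'cV[R]_Q) (b : 'cV[R]_B) (x : X) : 'M[R]_P :=
  appMx D (f - f0) x + diag_mx (Gamma *m b - b0)^T.

(* [eta] may be +oo, as the balls of [X] need not be compact; the constraint
   then fails unless [f = f0], in which case +oo * 0 = 0. *)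
Definition C_SOC (N : 'rV[R]_d -> R) (M : nat) (xt : 'I_M -> X)
    (delta : 'I_M -> R) : set ((X -> 'cV[R]_Q) * 'cV[R]_B) :=
  [set fb | carrier H fb.1 /\ forall m : 'I_M,
     let t := (eta N (xt m) (delta m) * (normH H (fb.1 - f0))%:E)%E in
     t \is a fin_num /\ loewner (fine t)%:M (affine_mx fb.1 fb.2 (xt m))].

Definition C_full (Kc : set X) : set ((X -> 'cV[R]_Q) * 'cV[R]_B) :=
  [set fb | carrier H fb.1 /\
     forall x, Kc x -> loewner 0 (affine_mx fb.1 fb.2 x)].

End Constraints.

(* Main.v *)
(* Every derivative f |-> d^r f_q(x) with |r| <= s is a bounded functional on the
   RKHS.  At an interior x, an iterated difference quotient of f_q is the inner
   product of f with the same difference quotient of y |-> K(., y) e_q; the inner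
   products of two such vectors are difference quotients of K_qq, equal by an
   iterated mean value theorem to values of d^{r,r} K_qq near (x, x).  By
   continuity of d^{r,r} K_qq the vectors are Cauchy in the RKHS, and their limit
   represents the derivative.  At other points of X the same Gram-matrix argument
   applies to the representers at interior points converging to x.  Hence
   D(f)(x) = <f, DK(., x)>, and Cauchy-Schwarz bounds the variation of
   u^T D(f - f0)(.) u on a ball by eta ||f - f0||. *)

Require Import Defs.
From mathcomp Require Import all_boot all_order all_algebra.
From mathcomp Require Import all_classical all_reals all_analysis.
From mathcomp Require Import ring lra.
Import Order.TTheory GRing.Theory Num.Theory.
Import numFieldNormedType.Exports.
Local Open Scope classical_set_scope.
Local Open Scope ring_scope.

Set Implicit Arguments.
Unset Strict Implicit.
Unset Printing Implicit Defensive.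

(* [iterD] alone would be [ssrnat.iterD]. *)
Local Notation iterD := Defs.iterD.

(** * Iterated difference quotients *)

Section DifferenceQuotients.
Context {R : realType} {n : nat}.
Implicit Types (w : seq 'I_n) (hs : seq R) (x : 'rV[R]_n).

Local Notation e i := (delta_mx 0 i : 'rV[R]_n).

(** The codomain is any [lmodType] because quotients are taken both of real functions and of maps
    into the RKHS. As in [iterD], the head of the list is outermost; with too few steps the value is
    a dummy 0. *)
Fixpoint diffq {V : lmodType R} w hs (F : 'rV[R]_n -> V) x : V :=
  if w is i :: w' then
    if hs is h :: hs' then
      h^-1 *: (diffq w' hs' F (x + h *: e i) - diffq w' hs' F x)
    else 0
  else F x.

(** A radius, in the sup norm, of a ball around [x] containing all the points at which
    [diffq w hs F x] samples [F]. *)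
Definition abs_sum hs : R := \sum_(h <- hs) `|h|.

Lemma abs_sum_cons h hs : abs_sum (h :: hs) = `|h| + abs_sum hs.
Proof. by rewrite /abs_sum big_cons. Qed.

Lemma abs_sum_rcons hs h : abs_sum (rcons hs h) = abs_sum hs + `|h|.
Proof. by rewrite /abs_sum -cats1 big_cat big_seq1. Qed.

Lemma abs_sum_ge0 hs : 0 <= abs_sum hs.
Proof. by apply: sumr_ge0 => h _. Qed.

Lemma abs_sum_le hs (r : R) : (forall h, h \in hs -> `|h| <= r) ->
  abs_sum hs <= (size hs)%:R * r.
Proof.
elim: hs => [|h hs IH] H; first by rewrite /abs_sum big_nil mul0r.
rewrite abs_sum_cons -[size _]add1n natrD mulrDl mul1r lerD ?H ?mem_head//.
by apply: IH => k hk; apply: H; rewrite inE hk orbT.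
Qed.

Lemma norm_delta_mx_le i : `|e i| <= 1.
Proof.
rewrite [leLHS]/Num.norm /= mx_normrE; apply/bigmax_leP; split=> // -[a b] _ /=.
by rewrite mxE; case: (_ && _); rewrite ?normr1 ?normr0.
Qed.

Lemma normZ_delta_mx (h : R) i : `|h *: e i| <= `|h|.
Proof. by rewrite normrZ ler_piMr// norm_delta_mx_le. Qed.

Lemma ler_distB_shift (x y v : 'rV[R]_n) : `|y - x| <= `|y - (x + v)| + `|v|.
Proof. by rewrite (le_trans _ (ler_normD _ _))// opprD addrA subrK. Qed.

Lemma diffq_cat (V : lmodType R) w1 w2 h1 h2 (F : 'rV[R]_n -> V) x :
  size w1 = size h1 -> diffq (w1 ++ w2) (h1 ++ h2) F x = diffq w1 h1 (diffq w2 h2 F) x.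
Proof.
by elim: w1 h1 x => [|i w1 IH] [|h h1] //= x [sz]; rewrite !IH.
Qed.

Lemma diffq_translate (V : lmodType R) w hs (F : 'rV[R]_n -> V) a x :
  diffq w hs (fun y => F (y + a)) x = diffq w hs F (x + a).
Proof.
elim: w hs x => [|i w IH] [|h hs] //= x; rewrite !IH.
by rewrite addrAC.
Qed.

Lemma diffqB (V : lmodType R) w hs (F G : 'rV[R]_n -> V) x :
  diffq w hs (fun y => F y - G y) x = diffq w hs F x - diffq w hs G x.
Proof.
elim: w hs x => [|i w IH] [|h hs] //= x; rewrite ?subr0// !IH -scalerBr.
by congr (_ *: _); rewrite !opprD !opprK addrACA.
Qed.

Lemma diffqZ (V : lmodType R) w hs (F : 'rV[R]_n -> V) (a : R) x :
  diffq w hs (fun y => a *: F y) x = a *: diffq w hs F x.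
Proof.
elim: w hs x => [|i w IH] [|h hs] //= x; rewrite ?scaler0// !IH -scalerBr.
by rewrite !scalerA mulrC.
Qed.

(** The innermost difference can be taken last, since the outer quotients are linear and commute
    with translations. *)
Lemma diffq_rcons (V : lmodType R) w hs i (h : R) (F : 'rV[R]_n -> V) x :
  size w = size hs ->
  diffq (rcons w i) (rcons hs h) F x =
  h^-1 *: (diffq w hs F (x + h *: e i) - diffq w hs F x).
Proof.
move=> sz; rewrite -!cats1 diffq_cat// diffqZ diffqB.
by rewrite diffq_translate.
Qed.

Lemma iterD_cat w1 w2 (g : 'rV[R]_n -> R) : iterD (w1 ++ w2) g = iterD w1 (iterD w2 g).
Proof. by elim: w1 => //= i w ->. Qed.

Lemma iter_derivable_cat (U : set 'rV[R]_n) w1 w2 (g : 'rV[R]_n -> R) :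
  iter_derivable U (w1 ++ w2) g <->
  iter_derivable U w2 g /\ iter_derivable U w1 (iterD w2 g).
Proof.
elim: w1 => /= [|i w [IH1 IH2]]; first by split=> [|[]].
by rewrite iterD_cat; split=> [[/IH1[? ?] ?]|[? [? ?]]]; split => //; exact: IH2.
Qed.

Lemma is_derive_translate (F : 'rV[R]_n -> R) (a v x : 'rV[R]_n) (dF : R) :
  is_derive (x + a) v F dF -> is_derive x v (fun y => F (y + a)) dF.
Proof.
move=> [dv dE]; suff E : (fun h : R => h^-1 *: (((fun y => F (y + a)) \o shift x) (h *: v)
    - F (x + a))) = (fun h => h^-1 *: ((F \o shift (x + a)) (h *: v) - F (x + a))).
  by split; rewrite /derivable /derive E.
by apply/funext => h /=; rewrite addrA.
Qed.

Lemma is_derive_line (F : 'rV[R]_n -> R) (v x : 'rV[R]_n) (t dF : R) :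
  is_derive (x + t *: v) v F dF -> is_derive t 1 (fun s => F (x + s *: v)) dF.
Proof.
move=> [dv dE]; suff E : (fun h : R => h^-1 *: (((fun s => F (x + s *: v)) \o shift t) (h *: 1)
    - F (x + t *: v))) = (fun h => h^-1 *: ((F \o shift (x + t *: v)) (h *: v) - F (x + t *: v))).
  by split; rewrite /derivable /derive E.
apply/funext => h /=; congr (_ *: (F _ - _)).
by rewrite [h *: 1]mulr1 scalerDl addrCA.
Qed.

(** A difference quotient is a finite linear combination of translates, and the sample points stay
    within [abs_sum hs] of [y]. *)
Lemma is_derive_diffq w hs (g : 'rV[R]_n -> R) (v y : 'rV[R]_n) :
  (forall y', `|y' - y| <= abs_sum hs -> derivable g y' v) ->
  is_derive y v (diffq w hs g) (diffq w hs ('D_v g) y).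
Proof.
elim: w hs y => [|i w IH] hs y H /=.
  by apply/derivableP/H; rewrite subrr normr0 abs_sum_ge0.
case: hs H => [|h hs] H; first exact: is_derive_cst.
have d1 : is_derive y v (diffq w hs g) (diffq w hs ('D_v g) y).
  apply: IH => y' hy'; apply: H; rewrite abs_sum_cons.
  by rewrite (le_trans hy')// lerDr.
have d2 : is_derive y v (fun z => diffq w hs g (z + h *: e i)) (diffq w hs ('D_v g) (y + h *: e i)).
  apply: is_derive_translate; apply: IH => y' hy'; apply: H; rewrite abs_sum_cons.
  rewrite [leRHS]addrC (le_trans (ler_distB_shift _ _ (h *: e i)))// lerD//.
  exact: normZ_delta_mx.
exact: is_deriveZ.
Qed.

(** Steps of either sign occur in the quotients, so the classical theorem is applied on [[0, h]] or
    on [[h, 0]]. *)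
Lemma MVT_signed (f df : R -> R) (h : R) :
  (forall t : R, `|t| <= `|h| -> is_derive t 1 f (df t)) ->
  exists2 c, `|c| <= `|h| & f h - f 0 = df c * h.
Proof.
move=> H; have cf a b : (forall t, a <= t <= b -> `|t| <= `|h|) -> {within `[a, b], continuous f}.
  move=> ab; apply: derivable_within_continuous => t; rewrite in_itv/= => /ab /H.
  by move=> [].
have [h0|h0] := leP 0 h.
  have ab t : 0 <= t <= h -> `|t| <= `|h| by move=> /andP[t0 th]; rewrite !ger0_norm.
  have d (t : R) : t \in `]0, h[ -> is_derive t 1 f (df t).
    by rewrite in_itv/= => /andP[t0 th]; apply: H; apply: ab; rewrite !ltW.
  have [c + E] := MVT_segment h0 d (cf _ _ ab).
  by rewrite in_itv/= => cI; exists c; [exact: ab|rewrite E subr0].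
have ab t : h <= t <= 0 -> `|t| <= `|h|.
  by move=> /andP[th t0]; rewrite !ler0_norm// ?lerN2// ltW.
have d (t : R) : t \in `]h, 0[ -> is_derive t 1 f (df t).
  by rewrite in_itv/= => /andP[t0 th]; apply: H; apply: ab; rewrite !ltW.
have [c + E] := MVT_segment (ltW h0) d (cf _ _ ab).
rewrite in_itv/= => cI; exists c; first exact: ab.
by rewrite -[LHS]opprB E sub0r mulrN opprK.
Qed.

(* The derivatives are peeled off from the innermost one: the outer difference
   quotients commute with it, so no symmetry of mixed derivatives is needed. *)
Lemma diffq_MVT (U : set 'rV[R]_n) w hs (g : 'rV[R]_n -> R) x :
  size w = size hs -> 0 \notin hs ->
  (forall y, `|y - x| <= abs_sum hs -> U y) -> iter_derivable U w g ->
  exists2 y, `|y - x| <= abs_sum hs & diffq w hs g x = iterD w g y.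
Proof.
elim/last_ind: w hs g x => [|w i IH] hs g x.
  move=> /esym/size0nil-> _ _ _; exists x => //.
  by rewrite subrr normr0 abs_sum_ge0.
case/lastP: hs => [|hs h]; first by rewrite size_rcons.
rewrite !size_rcons mem_rcons inE negb_or => -[sz] /andP[h0 hs0] HU.
rewrite -[rcons w i]cats1 iter_derivable_cat iterD_cat cats1 => -[[_ /= dg] dw].
have xe t : `|t| <= `|h| -> forall y', `|y' - (x + t *: e i)| <= abs_sum hs ->
    `|y' - x| <= abs_sum (rcons hs h).
  move=> th y' hy'; rewrite abs_sum_rcons.
  rewrite (le_trans (ler_distB_shift _ _ (t *: e i)))// lerD//.
  by rewrite (le_trans (normZ_delta_mx _ _)).
have [|c ch E] := @MVT_signed (fun t => diffq w hs g (x + t *: e i))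
    (fun t => diffq w hs ('D_(e i) g) (x + t *: e i)) h.
  move=> t th; apply: is_derive_line; apply: is_derive_diffq => y' hy'.
  by apply: dg; apply: HU; exact: (xe t).
have [|y hy Ey] := IH hs _ (x + c *: e i) sz hs0 _ dw.
- by move=> y hy; apply: HU; exact: (xe c).
- exists y; first exact: (xe c).
  by rewrite diffq_rcons// -Ey; move: E; rewrite scale0r addr0 => ->; rewrite [LHS]mulrC mulfK 1?eq_sym.
Qed.

End DifferenceQuotients.

(** * Joint and iterated limits; multi-indices as words *)

Section StepFilter.
Context {R : realType}.

(** All steps tend to 0 jointly, with no order among them, while staying nonzero. *)
Definition small_steps (k : nat) : set_system (seq R) :=
  filter_from [set r : R | 0 < r]
    (fun r => [set hs | size hs = k /\ forall h, h \in hs -> 0 < `|h| < r]).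

#[global] Instance small_steps_filter k : ProperFilter (small_steps k).
Proof.
apply: filter_from_proper; last first.
  move=> r /= r0; exists (nseq k (r / 2)); split; first by rewrite size_nseq.
  move=> h /nseqP[-> _].
  by rewrite gtr0_norm ?divr_gt0// ltr_pdivrMr// ltr_pMr// ltr1n.
apply: filter_from_filter; first by exists 1 => /=.
move=> r1 r2 /= r10 r20; exists (Num.min r1 r2); first by rewrite /= lt_min r10.
move=> hs [sz H]; split; split => // h /H; rewrite lt_min; first by case/and3P => -> ->.
by case/and3P => -> _ ->.
Qed.

Context {n : nat}.

(** Joint limits are iterated limits: for a fixed small outer step, the inner steps are sent to 0 by
    induction, and the resulting quotient of [iterD w g] inherits its closeness to the joint limit
    [l]. Existence of the derivatives is thus a consequence. *)
Lemma cvg_diffq_iterD (U : set 'rV[R]_n) (w : seq 'I_n) (g : 'rV[R]_n -> R) :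
  open U ->
  (forall u, suffix u w -> forall x, U x ->
     exists l : R, diffq u hs g x @[hs --> small_steps (size u)] --> l) ->
  forall x, U x -> diffq w hs g x @[hs --> small_steps (size w)] --> iterD w g x.
Proof.
move=> oU; elim: w => [|i w IH] H x Ux; first exact: cvg_cst.
have {}IH : forall y, U y -> diffq w hs g y @[hs --> small_steps (size w)] --> iterD w g y.
  by apply: IH => u uw; apply: H; case/suffixP: uw => v ->; rewrite -cat_cons suffix_suffix.
have [l cl] := H _ (suffix_refl _) x Ux.
suff c : h^-1 *: ((iterD w g \o shift x) (h *: (delta_mx 0 i : 'rV[R]_n)) - iterD w g x)
    @[h --> (0 : R)^'] --> l.
  by rewrite /= /derive (cvg_lim _ c).
apply/cvgrPdist_le => eps eps0.
have /cvgrPdist_le/(_ eps eps0)[r /= r0 Hr] := cl.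
(* Openness keeps the shifted point in [U], where the induction hypothesis applies. *)
have Ush : \forall h \near (0 : R)^', U (x + h *: (delta_mx 0 i : 'rV[R]_n)).
  have /nbhs_normP[e /= e0 He] : \forall y \near x, U y by exact: open_nbhs_nbhs.
  near=> h; apply: He; rewrite /ball_/= opprD addrA subrr sub0r normrN.
  rewrite (le_lt_trans (normZ_delta_mx _ _))//.
  by near: h; exact: dnbhs0_lt.
near=> h.
have h0 : 0 < `|h| by rewrite normr_gt0; near: h; exact: nbhs_dnbhs_neq.
have hr : `|h| < r by near: h; exact: dnbhs0_lt.
have Uh : U (x + h *: (delta_mx 0 i : 'rV[R]_n)) by near: h.
rewrite /= [_ + x]addrC.
(* The outer step [h] is frozen here and only the inner steps tend to 0. *)
have cq : `|l - diffq (i :: w) (h :: hs) g x| @[hs --> small_steps (size w)] -->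
    `|l - h^-1 *: (iterD w g (x + h *: (delta_mx 0 i : 'rV[R]_n)) - iterD w g x)|.
  by apply: cvg_norm; apply: cvgB; [exact: cvg_cst|apply: cvgZr; apply: cvgB; exact: IH].
rewrite -(cvg_lim _ cq)//; apply: limr_le; first exact: cvgP cq.
exists r => // hs [sz hhs]; apply: (Hr (h :: hs)); split => /=; first by rewrite sz.
by move=> k; rewrite inE => /orP[/eqP->|/hhs//]; rewrite h0.
Unshelve. all: by end_near.
Qed.

End StepFilter.

(** * Sorted words and multi-indices *)

Section MultiIndexWords.
Context {n : nat}.

Lemma mi_word_sorted (r : multi_index n) : sorted leq [seq val i | i <- mi_word r].
Proof.
rewrite sorted_map sorted_pairwise; last by move=> ? ? ?; exact: leq_trans.
have : pairwise (relpre val leq) (enum 'I_n).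
  by rewrite -sorted_pairwise;
    [rewrite -sorted_map val_enum_ord iota_sorted|move=> ? ? ?; exact: leq_trans].
rewrite /mi_word; elim: (enum _) => //= i s IH /andP[/allP his /IH ps].
rewrite pairwise_cat ps andbT; apply/andP; split.
  apply/allrelP => j k /nseqP[-> _] /flatten_mapP[l ls /nseqP[-> _]].
  exact: his.
by elim: (r i) => //= m ->; rewrite andbT; apply/allP => j /nseqP[-> _] /=.
Qed.

Lemma size_mi_word (r : multi_index n) : size (mi_word r) = mi_size r.
Proof.
rewrite /mi_word size_flatten /shape -map_comp sumnE big_map.
by rewrite /mi_size big_enum; apply: eq_bigr => i _; rewrite /= size_nseq.
Qed.

Lemma count_mem_mi_word (r : multi_index n) i : count_mem i (mi_word r) = r i.
Proof.
rewrite /mi_word count_flatten -map_comp sumnE big_map big_enum (bigD1 i)//=.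
rewrite count_nseq /= eqxx mul1n big1 ?addn0// => j /negPf ji.
by rewrite count_nseq /= ji.
Qed.

(** A suffix of a sorted word is sorted, and a sorted word is determined by its letter counts. This
    provides the lower-order derivatives required by [cvg_diffq_iterD]. *)
Lemma suffix_mi_word (r : multi_index n) u : suffix u (mi_word r) ->
  exists2 r' : multi_index n, u = mi_word r' & (mi_size r' <= mi_size r)%N.
Proof.
move=> /suffixP[v E]; pose r' : multi_index n := [ffun i => count_mem i u].
have Eu : u = mi_word r'.
  apply: (inj_map val_inj); apply: (sorted_eq leq_trans anti_leq _ (mi_word_sorted _)).
    have := mi_word_sorted r; rewrite E map_cat => /(drop_sorted (size v)).
    by rewrite drop_size_cat// size_map.
  by apply/perm_map/allP => i _ /=; rewrite count_mem_mi_word ffunE.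
by exists r' => //; rewrite -!size_mi_word E -Eu size_cat leq_addl.
Qed.

End MultiIndexWords.

Lemma enum_ordD (m n : nat) :
  enum 'I_(m + n) = [seq lshift n i | i <- enum 'I_m] ++ [seq rshift m i | i <- enum 'I_n].
Proof.
apply: (inj_map val_inj); rewrite val_enum_ord map_cat iotaD; congr (_ ++ _).
  by rewrite -map_comp -val_enum_ord; apply/eq_in_map => i _.
rewrite add0n -[X in iota X]addn0 iotaDl -val_enum_ord -[LHS]map_comp -[RHS]map_comp.
by apply/eq_in_map => i _.
Qed.

Lemma mi_word_double (d : nat) (r : multi_index d) :
  mi_word (mi_double r) =
  [seq lshift d i | i <- mi_word r] ++ [seq rshift d i | i <- mi_word r].
Proof.
rewrite /mi_word enum_ordD map_cat flatten_cat !map_flatten -!map_comp.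
congr (flatten _ ++ flatten _); apply: eq_map => i /=; rewrite map_nseq /mi_double ffunE.
  by rewrite (unsplitK (inl i)).
by rewrite (unsplitK (inr i)).
Qed.

(** * Partial derivatives on subsets and on products *)

Section Ext0.
Context {R : realType} {n : nat} {A : set 'rV[R]_n}.

Lemma ext0_val (f : A -> R) (x : A) : ext0 f (val x) = f x.
Proof. by rewrite /ext0 /valL_/= oinv_set_val valK. Qed.

Lemma ext0_out (f : A -> R) y : ~ A y -> ext0 f y = 0.
Proof. by move=> /mem_set nAy; rewrite /ext0 /valL_/= oinv_set_val insubN// -in_setC. Qed.

Definition interior_pt y (Ay : A° y) : A := SigSub (mem_set (interior_subset Ay)).

Lemma partial_interior r (f : A -> R) x :
  A° (val x) -> partial r f x = iterD (mi_word r) (ext0 f) (val x).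
Proof. by move=> Ax; rewrite /partial asboolT. Qed.

Lemma partial_boundary r (f : A -> R) x :
  ~ A° (val x) ->
  partial r f x = lim (iterD (mi_word r) (ext0 f) @ within A° (nbhs (val x))).
Proof. by move=> Ax; rewrite /partial asboolF. Qed.

(** Continuity for the subtype topology becomes an estimate in the ambient space, because open sets
    of [A] are traces of open sets. The point [z] may lie on the boundary. *)
Lemma partial_near r (f : A -> R) (z : A) (eps : R) :
  partial_exists_continuous r f -> 0 < eps ->
  exists2 del : R, 0 < del & forall y, A° y -> `|y - val z| < del ->
    `|partial r f z - iterD (mi_word r) (ext0 f) y| < eps.
Proof.
move=> [_ /(_ z) /cvgrPdist_lt/(_ eps) /[apply] cf].
have [_ [[C oC <-] Cz] CP] := cf.
have /nbhs_normP[del /= del0 Hdel] : nbhs (val z) C by exact: open_nbhs_nbhs.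
exists del => // y Ay yz.
have := CP (interior_pt Ay); rewrite (@partial_interior r f (interior_pt Ay))//; apply.
by apply: Hdel; rewrite /ball_/= distrC.
Qed.

End Ext0.

(** A directional derivative depends only on the values along one line; the two spaces may differ,
    so that derivatives on R^(d+d) reduce to derivatives on R^d. *)
Lemma eq_derive_dir {R : realType} (V V' : normedModType R) (f : V -> R) (g : V' -> R) v x v' x' :
  (forall h : R, f (h *: v + x) = g (h *: v' + x')) -> 'D_v f x = 'D_v' g x'.
Proof.
move=> fg; rewrite /derive; suff -> : (fun h : R => h^-1 *: ((f \o shift x) (h *: v) - f x)) =
    (fun h => h^-1 *: ((g \o shift x') (h *: v') - g x')) by [].
by apply/funext => h /=; rewrite fg; have := fg 0; rewrite !scale0r !add0r => ->.
Qed.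

(** * Derivatives and difference quotients in each of two arguments *)

Section Blocks.
Context {R : realType} {d : nat}.
Implicit Types (x y : 'rV[R]_d) (G : 'rV[R]_(d + d) -> R) (w : seq 'I_d).

Lemma scale_delta_lshift (h : R) i :
  h *: (delta_mx 0 (lshift d i) : 'rV[R]_(d + d)) = row_mx (h *: delta_mx 0 i) 0.
Proof. by rewrite delta_mx_lshift scale_row_mx scaler0. Qed.

Lemma scale_delta_rshift (h : R) i :
  h *: (delta_mx 0 (rshift d i) : 'rV[R]_(d + d)) = row_mx 0 (h *: delta_mx 0 i).
Proof. by rewrite delta_mx_rshift scale_row_mx scaler0. Qed.

Lemma iterD_lshift w G x y :
  iterD [seq lshift d i | i <- w] G (row_mx x y) =
  iterD w (fun x' => G (row_mx x' y)) x.
Proof.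
elim: w x => //= i w IH x; apply: eq_derive_dir => h.
by rewrite scale_delta_lshift add_row_mx add0r !IH.
Qed.

Lemma iterD_rshift w G x y :
  iterD [seq rshift d i | i <- w] G (row_mx x y) =
  iterD w (fun y' => G (row_mx x y')) y.
Proof.
elim: w y => //= i w IH y; apply: eq_derive_dir => h.
by rewrite scale_delta_rshift add_row_mx add0r !IH.
Qed.

Lemma iterD_blocks w1 w2 G x y :
  iterD ([seq lshift d i | i <- w1] ++ [seq rshift d i | i <- w2]) G (row_mx x y) =
  iterD w1 (fun x' => iterD w2 (fun y' => G (row_mx x' y')) y) x.
Proof.
rewrite iterD_cat iterD_lshift; congr (iterD w1 _ x).
by apply/funext => x'; rewrite iterD_rshift.
Qed.

Lemma diffq_lshift w hs G x y :
  diffq [seq lshift d i | i <- w] hs G (row_mx x y) =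
  diffq w hs (fun x' => G (row_mx x' y)) x.
Proof.
elim: w hs x => [|i w IH] [|h hs] x //=.
by rewrite scale_delta_lshift add_row_mx addr0 !IH.
Qed.

Lemma diffq_rshift w hs G x y :
  diffq [seq rshift d i | i <- w] hs G (row_mx x y) =
  diffq w hs (fun y' => G (row_mx x y')) y.
Proof.
elim: w hs y => [|i w IH] [|h hs] y //=.
by rewrite scale_delta_rshift add_row_mx addr0 !IH.
Qed.

Lemma diffq_blocks w1 w2 h1 h2 G x y : size w1 = size h1 ->
  diffq ([seq lshift d i | i <- w1] ++ [seq rshift d i | i <- w2]) (h1 ++ h2) G (row_mx x y) =
  diffq w1 h1 (fun x' => diffq w2 h2 (fun y' => G (row_mx x' y')) y) x.
Proof.
move=> sz; rewrite diffq_cat ?size_map// diffq_lshift; congr (diffq w1 h1 _ x).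
by apply/funext => x'; rewrite diffq_rshift.
Qed.

Lemma norm_row_mx_le x y (r : R) : (`|row_mx x y| <= r) = (`|x| <= r) && (`|y| <= r).
Proof.
have key m (v : 'rV[R]_m) : reflect (0 <= r /\ forall j, `|v 0 j| <= r) (`|v| <= r).
  apply: (iffP idP); rewrite [`|v|]/Num.norm /= mx_normrE.
    by move=> /bigmax_leP[r0 H]; split=> // j; exact: (H (0, j)).
  move=> [r0 H]; apply/bigmax_leP; split=> // -[i j] _ /=.
  by rewrite [i]ord1.
apply/key/andP => [[r0 H]|[/key[r0 Hx] /key[_ Hy]]].
  split; apply/key; split=> // j.
    by have := H (lshift d j); rewrite row_mxEl.
  by have := H (rshift d j); rewrite row_mxEr.
split=> // j; case: (fintype.splitP j) => k jk.
  by rewrite (_ : j = lshift d k) ?row_mxEl//; apply: val_inj.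
by rewrite (_ : j = rshift d k) ?row_mxEr//; apply: val_inj.
Qed.

Lemma interior_sqset (X : set 'rV[R]_d) x y :
  X° x -> X° y -> (sqset X)° (row_mx x y).
Proof.
move=> /nbhs_normP[e1 /= e10 H1] /nbhs_normP[e2 /= e20 H2].
apply/(nbhs_normP (row_mx x y) (sqset X)); exists (Num.min e1 e2); first by rewrite /= lt_min e10.
move=> z; rewrite /ball_/= -[z]hsubmxK opp_row_mx add_row_mx => zd.
have := lexx `|row_mx (x - lsubmx z) (y - rsubmx z)|.
rewrite norm_row_mx_le => /andP[]/le_lt_trans/(_ zd) + /le_lt_trans/(_ zd).
rewrite !lt_min => /andP[xz _] /andP[_ yz].
by split; [apply: H1; rewrite row_mxKl|apply: H2; rewrite row_mxKr].
Qed.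

End Blocks.

(** * Convergence in the RKHS *)

Section HilbertSpace.
Context {R : realType} {d Q : nat} {X : set 'rV[R]_d}.
Context {K : X -> X -> 'M[R]_Q} (H : rkhs K).
Implicit Types f g h : X -> 'cV[R]_Q.

Lemma carrierB f g : carrier H f -> carrier H g -> carrier H (f - g).
Proof. by move=> cf cg; rewrite -scaleN1r; apply: carrierD => //; exact: carrierZ. Qed.

Lemma ipDr f g h : carrier H f -> carrier H g -> carrier H h ->
  ip H f (g + h) = ip H f g + ip H f h.
Proof. by move=> cf cg ch; rewrite ipC ?ipDl// ?[ip H _ f]ipC//; exact: carrierD. Qed.

Lemma ipZr (a : R) f g : carrier H f -> carrier H g -> ip H f (a *: g) = a * ip H f g.
Proof. by move=> cf cg; rewrite ipC ?ipZl// ?[ip H _ f]ipC//; exact: carrierZ. Qed.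

Lemma ipBl f g h : carrier H f -> carrier H g -> carrier H h ->
  ip H (f - g) h = ip H f h - ip H g h.
Proof.
by move=> cf cg ch; rewrite -scaleN1r ipDl ?ipZl ?mulN1r//; exact: carrierZ.
Qed.

Lemma ipBr f g h : carrier H f -> carrier H g -> carrier H h ->
  ip H f (g - h) = ip H f g - ip H f h.
Proof.
by move=> cf cg ch; rewrite -scaleN1r ipDr ?ipZr ?mulN1r//; exact: carrierZ.
Qed.

Lemma ip0r f : carrier H f -> ip H f 0 = 0.
Proof. by move=> cf; rewrite -[X in ip H f X](scale0r f) ipZr// mul0r. Qed.

Lemma carrier_sum I (s : seq I) (F : I -> X -> 'cV[R]_Q) :
  (forall i, carrier H (F i)) -> carrier H (\sum_(i <- s) F i).
Proof. by move=> cF; elim/big_ind: _ => //; [exact: carrier0|exact: carrierD]. Qed.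

Lemma ip_sumr I (s : seq I) (F : I -> X -> 'cV[R]_Q) f :
  carrier H f -> (forall i, carrier H (F i)) ->
  ip H f (\sum_(i <- s) F i) = \sum_(i <- s) ip H f (F i).
Proof.
move=> cf cF; elim: s => [|i s IH]; first by rewrite !big_nil ip0r.
by rewrite !big_cons ipDr// ?IH//; exact: carrier_sum.
Qed.

Lemma normH_ge0 f : 0 <= normH H f. Proof. exact: sqrtr_ge0. Qed.

Lemma normH_sqr f : carrier H f -> normH H f ^+ 2 = ip H f f.
Proof. by move=> cf; rewrite sqr_sqrtr// ip_ge0. Qed.

(** Cauchy-Schwarz. *)
Lemma ip_le_normH f g : carrier H f -> carrier H g ->
  `|ip H f g| <= normH H f * normH H g.
Proof.
move=> cf cg; rewrite -(@ler_pXn2r _ 2)// ?nnegrE ?mulr_ge0 ?normH_ge0//.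
rewrite exprMn !normH_sqr// real_normK ?num_real//.
have [/(ip_eq0 cg) ->|g0] := eqVneq (ip H g g) 0.
  by rewrite ip0r// expr0n mulr_ge0// ip_ge0//; exact: carrier0.
have gp : 0 < ip H g g by rewrite lt_def g0 ip_ge0.
(* Up to the factor [ip H g g], this is the component of [f] orthogonal to [g]. *)
pose p := ip H g g *: f - ip H f g *: g.
have cp : carrier H p by apply: carrierB; exact: carrierZ.
have : 0 <= ip H p p by exact: ip_ge0.
have -> : ip H p p = ip H g g * (ip H f f * ip H g g - ip H f g ^+ 2).
  have cgf := carrierZ (ip H g g) cf; have cfg := carrierZ (ip H f g) cg.
  rewrite /p ipBl ?ipBr// !ipZl// !ipZr// [ip H g f]ipC//.
  by ring.
by rewrite pmulr_rge0// subr_ge0.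
Qed.

Lemma normHB f g : carrier H f -> carrier H g -> normH H (f - g) = normH H (g - f).
Proof.
move=> cf cg; rewrite /normH !(ipBl, ipBr)//; do ?exact: carrierB.
by rewrite [ip H g f]ipC//; congr Num.sqrt; ring.
Qed.

Lemma normH_triangle f g : carrier H f -> carrier H g ->
  normH H (f + g) <= normH H f + normH H g.
Proof.
move=> cf cg; rewrite -(@ler_pXn2r _ 2)// ?nnegrE ?addr_ge0 ?normH_ge0//.
rewrite sqrrD !normH_sqr//; last exact: carrierD.
rewrite ipDl ?ipDr// 1?[ip H g f]ipC//; last exact: carrierD.
have := le_trans (ler_norm _) (ip_le_normH cf cg).
by lra.
Qed.

(** If all Gram entries approach one value [V], the squared distances approach V - V - V + V = 0. So
    the family is Cauchy, has a limit by completeness, and inner products converge by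
    Cauchy-Schwarz. *)
Lemma gram_cvg (T : Type) (F : set_system T) (FF : ProperFilter F)
    (Psi : T -> X -> 'cV[R]_Q) (V : R) :
  (forall t, carrier H (Psi t)) ->
  (forall eps : R, 0 < eps -> exists2 S, F S & forall t t', S t -> S t' ->
     `|V - ip H (Psi t) (Psi t')| < eps) ->
  exists2 k, carrier H k & forall f, carrier H f -> ip H f (Psi t) @[t --> F] --> ip H f k.
Proof.
move=> cPsi gram.
(* The squared distance involves four Gram entries, each within [eps ^+ 2 / 4] of [V]. *)
have dist_lt (eps : R) S : 0 < eps -> (forall t t', S t -> S t' ->
    `|V - ip H (Psi t) (Psi t')| < eps ^+ 2 / 4) ->
    forall t t', S t -> S t' -> normH H (Psi t - Psi t') < eps.
  move=> eps0 HS t t' St St'.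
  rewrite -(@ltr_pXn2r _ 2)// ?nnegrE ?normH_ge0 ?(ltW eps0)//.
  rewrite normH_sqr; last exact: carrierB.
  rewrite ipBl ?ipBr//; last exact: carrierB.
  have := HS _ _ St St; have := HS _ _ St' St'; have := HS _ _ St St'; have := HS _ _ St' St.
  rewrite !ltr_norml => /andP[? ?] /andP[? ?] /andP[? ?] /andP[? ?].
  by lra.
have /choice[S HS] : forall n, exists S : set T, F S /\ forall t t', S t -> S t' ->
    normH H (Psi t - Psi t') < n.+1%:R^-1.
  move=> n; have n0 : 0 < (n.+1%:R^-1 : R) by rewrite invr_gt0.
  have [|S FS HS] := gram (n.+1%:R^-1 ^+ 2 / 4); first by rewrite divr_gt0// exprn_gt0.
  by exists S; split=> //; exact: dist_lt.
(* Completeness is stated for sequences: [t n] is picked in all of [S 0], ..., [S n], so each [S i]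
   contains the tail of the sequence from [i] on. *)
have FI n : F [set t | forall i, (i <= n)%N -> S i t].
  elim: n => [|n IH].
    by apply: filterS (HS 0%N).1 => t S0 i; rewrite leqn0 => /eqP->.
  apply: filterS (filterI IH (HS n.+1).1) => t [Sn Sn1] i.
  by rewrite leq_eqVlt => /orP[/eqP->//|]; exact: Sn.
have /choice[t Ht] : forall n, exists t, forall i, (i <= n)%N -> S i t.
  by move=> n; exact: filter_ex (FI n).
have small (eps : R) : 0 < eps -> exists n0 : nat, n0.+1%:R^-1 < eps.
  by move=> eps0; have [n0 _ Hn] := near_infty_natSinv_lt (PosNum eps0);
    exists n0; exact: (Hn n0 (leqnn n0)).
have [k ck kt] : exists2 k, carrier H k & normH H (Psi (t n) - k) @[n --> \oo] --> (0 : R).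
  apply: carrier_complete => // eps /small[n0 Hn0]; exists n0 => m n n0m n0n.
  by rewrite (lt_trans _ Hn0)//; apply: (HS n0).2; exact: Ht.
exists k => // f cf; apply/cvgrPdist_lt => eps eps0.
(* Chosen so that [(normH H f + 1) * (e + e) = eps]; adding 1 keeps the divisor positive. *)
pose e := eps / (normH H f + 1) / 2.
have f1 : 0 < normH H f + 1 by rewrite ltr_wpDl// normH_ge0.
have e0 : 0 < e by rewrite !divr_gt0.
have [n0 Hn0] := small _ e0.
have [n1 _ Hn1] := (@cvgrPdist_lt _ _ _ _ _ _ _).1 kt e e0.
pose n := maxn n0 n1.
apply: filterS (HS n0).1 => t' St'.
have lt1 : normH H (k - Psi t') < e + e.
  have ckt := carrierB ck (cPsi (t n)); have ctt := carrierB (cPsi (t n)) (cPsi t').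
  rewrite -[k](subrK (Psi (t n))) -addrA (le_lt_trans (normH_triangle ckt ctt))//.
  apply: ltrD.
    have Hn : `|0 - normH H (Psi (t n) - k)| < e by exact: (Hn1 n (leq_maxr _ _)).
    rewrite normHB//; apply: le_lt_trans Hn.
    by rewrite sub0r normrN ler_norm.
  by rewrite (lt_trans _ Hn0)//; apply: (HS n0).2 => //; apply: Ht; exact: leq_maxl.
rewrite -ipBr//; apply: (le_lt_trans (ip_le_normH cf (carrierB ck (cPsi t')))).
have -> : eps = (normH H f + 1) * (e + e) by rewrite /e; field; rewrite gt_eqF.
apply: (le_lt_trans (ler_wpM2l (normH_ge0 f) (ltW lt1))).
by rewrite ltr_pM2r ?ltrDl// addr_gt0.
Qed.

End HilbertSpace.

(** * Representers of derivatives *)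

Section Representers.
Context {R : realType} {d Q : nat} {X : set 'rV[R]_d}.
Context {K : X -> X -> 'M[R]_Q} (H : rkhs K) (q : 'I_Q).
Implicit Types (f : X -> 'cV[R]_Q) (x y : 'rV[R]_d) (w : seq 'I_d) (hs : seq R).

(* The representer of the evaluation of the [q]-th component at [y], extended by
   0 outside [X] so that difference quotients can be taken in 'rV_d. *)
Definition evalrep y : X -> 'cV[R]_Q :=
  if (insub y : option X) is Some x then fun x' : X => K x' x *m delta_mx q 0 else 0.

Lemma evalrep_val (x : X) : evalrep (val x) = fun t : X => K t x *m delta_mx q 0.
Proof. by rewrite /evalrep valK. Qed.

Lemma dotv_delta (u : 'cV[R]_Q) j : dotv u (delta_mx j 0) = u j 0.
Proof. by rewrite /dotv -colE !mxE. Qed.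

Lemma carrier_evalrep y : carrier H (evalrep y).
Proof. by rewrite /evalrep; case: insubP => *; [exact: carrierK|exact: carrier0]. Qed.

Lemma ip_evalrep f y : carrier H f -> ip H f (evalrep y) = ext0 (fun t => f t q 0) y.
Proof.
move=> cf; rewrite /evalrep; case: insubP => [x _ <-|yX].
  by rewrite ip_reproducing// dotv_delta ext0_val.
by rewrite ip0r// ext0_out// => /mem_set; exact/negP.
Qed.

Lemma carrier_diffq w hs (Psi : 'rV[R]_d -> X -> 'cV[R]_Q) x :
  (forall y, carrier H (Psi y)) -> carrier H (diffq w hs Psi x).
Proof.
move=> cPsi; elim: w hs x => [|i w IH] [|h hs] x //=; first exact: carrier0.
by apply: carrierZ; exact: carrierB.
Qed.

Lemma ip_diffq w hs (Psi : 'rV[R]_d -> X -> 'cV[R]_Q) x f :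
  carrier H f -> (forall y, carrier H (Psi y)) ->
  ip H f (diffq w hs Psi x) = diffq w hs (fun y => ip H f (Psi y)) x.
Proof.
move=> cf cPsi.
elim: w hs x => [|i w IH] [|h hs] x //=; first exact: ip0r.
by rewrite ipZr ?ipBr ?IH//; do ?apply: carrierB; exact: carrier_diffq.
Qed.

Definition kernel_entry (z : sqset X) : R := K (sq_fst z) (sq_snd z) q q.

Definition diag_pt (x : X) : sqset X.
Proof.
exists (row_mx (val x) (val x)); apply/mem_set.
by split; rewrite ?row_mxKl ?row_mxKr; exact: set_valP.
Defined.

(** Pairing with [evalrep y] evaluates at [y], which therefore becomes the first kernel argument.
    Both sides vanish if a point is outside [X]. *)
Lemma ip_evalrep2 x y :
  ip H (evalrep x) (evalrep y) = ext0 kernel_entry (row_mx y x).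
Proof.
rewrite ip_evalrep; last exact: carrier_evalrep.
have [Xy|nXy] := pselect (X y); last first.
  by rewrite !ext0_out//= => -[]; rewrite row_mxKl.
have [Xx|nXx] := pselect (X x); last first.
  rewrite [RHS]ext0_out; last by case; rewrite row_mxKr.
  rewrite /evalrep insubN; last by rewrite notin_setE.
  by rewrite (ext0_val _ (SigSub (mem_set Xy))) mxE.
have zX : sqset X (row_mx y x) by split; rewrite ?row_mxKl ?row_mxKr.
rewrite (ext0_val _ (SigSub (mem_set Xy))) (ext0_val _ (SigSub (mem_set zX))).
have -> : evalrep x = fun t : X => K t (SigSub (mem_set Xx)) *m delta_mx q 0
  := evalrep_val (SigSub (mem_set Xx)).
rewrite -colE mxE.
by congr (K _ _ _ _); apply: val_inj; rewrite /= ?row_mxKl ?row_mxKr.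
Qed.

(** Quotients pass through both sides of the inner product; the swap in [ip_evalrep2] puts [hs'] in
    the first block. *)
Lemma gram_diffq w hs hs' x : size w = size hs' ->
  ip H (diffq w hs evalrep x) (diffq w hs' evalrep x) =
  diffq ([seq lshift d i | i <- w] ++ [seq rshift d i | i <- w]) (hs' ++ hs)
    (ext0 kernel_entry) (row_mx x x).
Proof.
have cE := carrier_evalrep; move=> sz.
rewrite diffq_blocks// ip_diffq//; last exact: carrier_diffq.
congr (diffq w hs' _ x); apply/funext => y.
rewrite ipC//; last exact: carrier_diffq.
rewrite ip_diffq//; congr (diffq w hs _ x); apply/funext => y'.
by rewrite ipC// ip_evalrep2.
Qed.

Lemma diffq_representer (r : multi_index d) (x : X) :
  partial_exists_continuous (mi_double r) kernel_entry -> X° (val x) ->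
  exists2 k, carrier H k & forall f, carrier H f ->
    diffq (mi_word r) hs (ext0 (fun t => f t q 0)) (val x)
      @[hs --> small_steps (size (mi_word r))] --> ip H k f.
Proof.
set w := mi_word r => Kr Xx.
pose V : R := partial (mi_double r) kernel_entry (diag_pt x).
have Zx := interior_sqset Xx Xx.
have [||k ck Hk] := @gram_cvg _ _ _ _ _ H _ (small_steps (size w)) _
    (fun hs => if size hs == size w then diffq w hs evalrep (val x) else 0) V.
- by move=> hs; case: ifP => _; [exact/carrier_diffq/carrier_evalrep|exact: carrier0].
- move=> eps /(partial_near (diag_pt x) Kr)[del del0 Hdel].
  have /nbhs_normP[rho /= rho0 Hrho] : nbhs (row_mx (val x) (val x)) (sqset X)° by exact: nbhs_interior.
  (* Within [rho] the kernel entry is differentiable; within [del] its derivative is close to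
     [V]. *)
  pose m := Num.min del rho; have m0 : 0 < m by rewrite lt_min del0.
  (* Two lists of steps below [c] have total length at most [2 * size w * c], which is less than
     [m]. *)
  pose c : R := m / ((size w)%:R * 2 + 1).
  have c0 : 0 < c by rewrite divr_gt0// ltr_wpDl// mulr_ge0.
  exists [set hs | size hs = size w /\ forall h, h \in hs -> 0 < `|h| < c]; first by exists c.
  move=> hs hs' [sz Hhs] [sz' Hhs']; rewrite sz sz' eqxx gram_diffq//.
  have small (z : 'rV[R]_(d + d)) : `|z - row_mx (val x) (val x)| <= abs_sum (hs' ++ hs) ->
      `|z - row_mx (val x) (val x)| < m.
    move=> /le_lt_trans; apply; rewrite /abs_sum big_cat/= -/(abs_sum hs) -/(abs_sum hs').
    have Shs : abs_sum hs <= (size w)%:R * c.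
      by rewrite -sz abs_sum_le// => h /Hhs/andP[_ /ltW].
    have Shs' : abs_sum hs' <= (size w)%:R * c.
      by rewrite -sz' abs_sum_le// => h /Hhs'/andP[_ /ltW].
    have -> : m = ((size w)%:R * 2 + 1) * c by rewrite /c mulrC divfK// gt_eqF// ltr_wpDl// mulr_ge0.
    lra.
  have [||||z zx ->] := @diffq_MVT _ _ (sqset X)°
    ([seq lshift d i | i <- w] ++ [seq rshift d i | i <- w])
    (hs' ++ hs) (ext0 kernel_entry) (row_mx (val x) (val x)).
  + by rewrite !size_cat !size_map sz sz'.
  + by rewrite mem_cat; apply/negP => /orP[/Hhs'|/Hhs]; rewrite normr0 ltxx.
  + by move=> z zx; apply: Hrho; rewrite /ball_/= distrC (lt_le_trans (small _ zx))// ge_min lexx orbT.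
  + by rewrite -mi_word_double; exact: Kr.1.
  rewrite -mi_word_double; apply: Hdel; last by rewrite (lt_le_trans (small _ zx))// ge_min lexx.
  by apply: Hrho; rewrite /ball_/= distrC (lt_le_trans (small _ zx))// ge_min lexx orbT.
exists k => // f cf.
rewrite ipC//; apply: cvg_trans (Hk f cf).
apply: near_eq_cvg; exists 1 => //= hs [-> _]; rewrite eqxx ip_diffq//; last exact: carrier_evalrep.
by congr (diffq w hs _ _); apply/funext => y; rewrite ip_evalrep.
Qed.

End Representers.
Arguments kernel_entry {R d Q X} K q z.

(** * Representers of partial derivatives, up to the boundary, and of the operators *)

Section DerivativeRepresenters.
Context {R : realType} {d Q s : nat} {X : set 'rV[R]_d}.
Context {K : X -> X -> 'M[R]_Q} (H : rkhs K) (hKs : Css s K).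
Implicit Types (f : X -> 'cV[R]_Q).

(** Smoothness of the members of the RKHS is not assumed: [diffq_representer], applied to every
    suffix of the word, gives the joint limits that [cvg_diffq_iterD] turns into derivatives. *)
Lemma iterD_representer q (r : multi_index d) (x : 'rV[R]_d) : (mi_size r <= s)%N -> X° x ->
  exists2 k, carrier H k & forall f, carrier H f ->
    iterD (mi_word r) (ext0 (fun t => f t q 0)) x = ip H k f.
Proof.
have rep r' y : (mi_size r' <= s)%N -> X° y -> exists2 k, carrier H k &
    forall f, carrier H f -> diffq (mi_word r') hs (ext0 (fun t => f t q 0)) y
      @[hs --> small_steps (size (mi_word r'))] --> ip H k f.
  move=> r's Xy; apply: (@diffq_representer _ _ _ _ _ H q r' (interior_pt Xy)) => //.
  exact: hKs.
move=> rs Xx; have [k ck Hk] := rep r x rs Xx; exists k => // f cf.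
suff c : diffq (mi_word r) hs (ext0 (fun t => f t q 0)) x @[hs --> small_steps (size (mi_word r))]
    --> iterD (mi_word r) (ext0 (fun t => f t q 0)) x.
  by apply: cvg_unique c _ => //; exact: Hk.
apply: (cvg_diffq_iterD (open_interior X)) => // u /suffix_mi_word[r' -> r'r] y Xy.
have [k' _ Hk'] := rep r' y (leq_trans r'r rs) Xy.
by exists (ip H k' f); exact: Hk'.
Qed.

Lemma partial_representer q (r : multi_index d) (x : X) :
  X `<=` closure X° -> (mi_size r <= s)%N ->
  exists2 k, carrier H k & forall f, carrier H f ->
    partial r (fun t => f t q 0) x = ip H k f.
Proof.
move=> hX rs; have [Xx|nXx] := pselect (X° (val x)).
  have [k ck Hk] := iterD_representer q rs Xx.
  by exists k => // f cf; rewrite partial_interior// Hk.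
have /choice[k Hk] : forall y : 'rV[R]_d, exists k, carrier H k /\ (X° y -> forall f, carrier H f ->
    iterD (mi_word r) (ext0 (fun t => f t q 0)) y = ip H k f).
  move=> y; have [Xy|nXy] := pselect (X° y); last by exists 0; split; [exact: carrier0|].
  by have [k ck Hk] := iterD_representer q rs Xy; exists k.
have ck y : carrier H (k y) := (Hk y).1.
have kE y f : X° y -> carrier H f ->
    iterD (mi_word r) (ext0 (fun t => f t q 0)) y = ip H (k y) f by move=> Xy; exact: (Hk y).2.
have ce := carrier_evalrep H q.
(* Each representer is itself in the RKHS, so [kE] applies twice and differentiates the kernel in
   both arguments. *)
have gram y y' : X° y -> X° y' -> ip H (k y) (k y') =
    iterD (mi_word (mi_double r)) (ext0 (kernel_entry K q)) (row_mx y y').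
  move=> Xy Xy'; rewrite -kE// mi_word_double iterD_blocks.
  congr (iterD _ _ y); apply/funext => z.
  rewrite -(@ip_evalrep _ _ _ _ _ H q)// -kE//.
  congr (iterD _ _ y'); apply/funext => z'.
  by rewrite -(@ip_evalrep _ _ _ _ _ H q)// ipC// (ip_evalrep2 H).
(* Density of the interior makes limits from the interior meaningful at [x]. *)
have FF : ProperFilter (within X° (nbhs (val x))).
  by apply: within_nbhs_proper; apply: hX; exact: set_valP.
have [|k0 ck0 Hk0] := @gram_cvg _ _ _ _ _ H _ _ FF k
    (partial (mi_double r) (kernel_entry K q) (diag_pt x)) ck _; last first.
  exists k0 => // f cf; rewrite partial_boundary// ipC//.
  apply: cvg_lim => //; apply: cvg_trans (Hk0 f cf).
  apply: near_eq_cvg; apply: (filterS _ (withinT X° (nbhs_filter (val x)))) => y Xy.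
  by rewrite kE// ipC.
move=> eps /(partial_near (diag_pt x) (hKs rs q q))[del del0 Hdel].
exists [set y | X° y /\ `|y - val x| <= del / 2].
  have /nbhs_normP : exists2 e : R, 0 < e &
      [set y | `|val x - y| < e] `<=` [set y | X° y -> X° y /\ `|y - val x| <= del / 2].
    by exists (del / 2); [rewrite divr_gt0|move=> y /ltW yx Xy; rewrite distrC].
  by [].
move=> y y' [Xy yx] [Xy' yx']; rewrite gram//; apply: Hdel; first exact: interior_sqset.
rewrite /= opp_row_mx add_row_mx; apply: (@le_lt_trans _ _ (del / 2)).
  by rewrite norm_row_mx_le yx.
by rewrite ltr_pdivrMr// ltr_pMr// ltr1n.
Qed.

(** A representer [k0] is assembled from those of the partial derivatives, then identified with
    [appK] by reproduction: its [j]-th entry at [t] is [D] applied to [K(., t) e_j], and kernel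
    symmetry exchanges the arguments. *)
Lemma appQ_representer (hK : mx_kernel K) (D : diffop R Q d s) (x : X) :
  X `<=` closure X° ->
  carrier H (fun t => appK D K t x) /\
  forall f, carrier H f -> appQ D f x = ip H f (fun t => appK D K t x).
Proof.
move=> hX.
have rep1 q (D1 : diffop1 R d s) : exists k, carrier H k /\ forall f, carrier H f ->
    app1 D1 (fun t => f t q 0) x = ip H k f.
  rewrite /app1; case: D1 => ts /=; elim: ts => [_|[c r] ts IH /= /andP[rs tss]].
    exists 0; split; first exact: carrier0.
    by move=> f cf; rewrite big_nil ipC ?ip0r//; exact: carrier0.
  have [k1 [ck1 Hk1]] := IH tss; have [k2 ck2 Hk2] := partial_representer q x hX rs.
  have ck2' := carrierZ c ck2.
  exists (c *: k2 + k1); split; first exact: carrierD.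
  by move=> f cf; rewrite big_cons ipDl// ipZl// Hk1// Hk2.
have /choice[k Hk] q := rep1 q (comp_op D q).
have ck q : carrier H (coef D q *: k q) by apply: carrierZ; exact: (Hk q).1.
pose k0 := \sum_q coef D q *: k q.
have ck0 : carrier H k0 by exact: carrier_sum.
have k0E f : carrier H f -> appQ D f x = ip H f k0.
  move=> cf; rewrite ip_sumr//; apply: eq_bigr => q _.
  by rewrite ipZr ?(Hk q).2// 1?ipC//; exact: (Hk q).1.
suff -> : (fun t => appK D K t x) = k0 by [].
apply/funext => t; apply/matrixP => j a; rewrite [a]ord1.
have ce := carrier_evalrep H j (val t).
rewrite -[RHS](ext0_val (fun t => k0 t j 0)) -(@ip_evalrep _ _ _ _ _ H j)// ipC// -k0E//.
rewrite summxE; apply: eq_bigr => q _; rewrite mxE -colE !mxE; congr (_ * app1 _ _ _).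
by apply/funext => y; rewrite evalrep_val -colE mxE hK.1 mxE.
Qed.

End DerivativeRepresenters.

(** * Quadratic forms and the constraint sets *)

Section EuclideanForms.
Context {R : realType} {n : nat}.
Implicit Types (u v : 'cV[R]_n) (A : 'M[R]_n).

Lemma quad_formE A u : dotv u (A *m u) = \sum_i \sum_j u i 0 * u j 0 * A i j.
Proof.
rewrite /dotv mxE; apply: eq_bigr => i _; rewrite !mxE mulr_sumr.
by apply: eq_bigr => j _; rewrite mulrA mulrAC.
Qed.

Lemma quad_formB A A' u :
  dotv u (A *m u) - dotv u (A' *m u) = \sum_i \sum_j u i 0 * u j 0 * (A i j - A' i j).
Proof.
rewrite !quad_formE -sumrB; apply: eq_bigr => i _.
by rewrite -sumrB; apply: eq_bigr => j _; rewrite mulrBr.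
Qed.

Lemma quad_formB_scalar A (a : R) u :
  dotv u ((A - a%:M) *m u) = dotv u (A *m u) - a * dotv u u.
Proof. by rewrite /dotv mulmxBl mulmxBr mul_scalar_mx -scalemxAr !mxE. Qed.

Lemma dotv_ge0 u : 0 <= dotv u u.
Proof. by rewrite /dotv mxE sumr_ge0// => i _; rewrite mxE -expr2 sqr_ge0. Qed.

Lemma dotv_eq0 u : dotv u u = 0 -> u = 0.
Proof.
rewrite /dotv mxE => /eqP; rewrite psumr_eq0 => [/allP H|i _]; last by rewrite mxE -expr2 sqr_ge0.
apply/matrixP => i j; rewrite [j]ord1 mxE; have := H i (mem_index_enum i).
by rewrite /= mxE mulf_eq0 orbb => /eqP.
Qed.

Lemma dotv_usphere u : usphere u -> dotv u u = 1.
Proof. by move=> u1; rewrite -[LHS]sqr_sqrtr ?dotv_ge0// -[Num.sqrt _]/(enorm u) u1 expr1n. Qed.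

(** The form is homogeneous of degree 2, so a nonzero vector can be normalised. *)
Lemma quad_form_ge0 A : (forall u, usphere u -> 0 <= dotv u (A *m u)) ->
  forall v, 0 <= dotv v (A *m v).
Proof.
move=> H v; have [/dotv_eq0 ->|v0] := eqVneq (dotv v v) 0.
  by rewrite mulmx0 /dotv mulmx0 mxE.
have e0 : enorm v != 0 by rewrite sqrtr_eq0 -ltNge lt_def v0 dotv_ge0.
have dZ (a : R) u w : dotv (a *: u) (a *: w) = a ^+ 2 * dotv u w.
  by rewrite /dotv [(a *: u)^T]linearZ -scalemxAl -scalemxAr scalerA mxE.
rewrite -[v](scalerKV e0) -scalemxAr dZ mulr_ge0 ?sqr_ge0//; apply: H.
rewrite /usphere /= /enorm dZ sqrtrM ?sqr_ge0// sqrtr_sqr ger0_norm ?invr_ge0 ?sqrtr_ge0//.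
by rewrite -/(enorm v) mulVf.
Qed.

End EuclideanForms.

(** * From the constraints at the ball centres to the whole compact set *)

Theorem theorem3 (R : realType) (d Q s P B M : nat)
    (X : set 'rV[R]_d) (hX : X `<=` closure X°)
    (N : 'rV[R]_d -> R) (hN : is_norm N)
    (K : X -> X -> 'M[R]_Q) (hK : mx_kernel K) (hKs : Css s K)
    (H : rkhs K)
    (Kc : set X) (hKc : compact Kc)
    (hP : (1 <= P)%N)
    (f0 : X -> 'cV[R]_Q) (hf0 : carrier H f0)
    (b0 : 'cV[R]_P) (Gamma : 'M[R]_(P, B))
    (D : 'I_P -> 'I_P -> diffop R Q d s)
    (hD : forall f, carrier H f -> forall x : X, (appMx D f x)^T = appMx D f x)
    (xt : 'I_M -> X) (delta : 'I_M -> R) (hdelta : forall m, 0 < delta m)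
    (hcover : Kc `<=` \bigcup_(m in [set: 'I_M]) ballX N (xt m) (delta m)) :
  C_SOC H D f0 b0 Gamma N xt delta `<=` C_full H D f0 b0 Gamma Kc.
Proof.
move=> [f b] [/= cf HS]; split=> //= x Kx.
have [m _ xm] := hcover x Kx.
have [tfin [_ Hm]] := HS m.
set phi := f - f0 in tfin Hm *; have cphi : carrier H phi by exact: carrierB.
rewrite /loewner subr0; split.
  by rewrite /affine_mx linearD/= hD// tr_diag_mx.
apply: quad_form_ge0 => u u1.
pose g p1 p2 : X -> 'cV[R]_Q :=
  (fun t => appK (D p1 p2) K t (xt m)) - (fun t => appK (D p1 p2) K t x).
have cg p1 p2 : carrier H (g p1 p2).
  by apply: carrierB; exact: (appQ_representer H hKs hK _ _ hX).1.
(* [G] represents the change of the quadratic form at [u] between [x] and the centre [xt m]. *)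
pose G : X -> 'cV[R]_Q := \sum_p1 \sum_p2 (u p1 0 * u p2 0) *: g p1 p2.
have cG1 p1 : carrier H (\sum_p2 (u p1 0 * u p2 0) *: g p1 p2).
  by apply: carrier_sum => p2; exact: carrierZ.
have cG : carrier H G by exact: carrier_sum.
have GE : G = fun t => \sum_p1 \sum_p2 (u p1 0 * u p2 0) *:
    (appK (D p1 p2) K t (xt m) - appK (D p1 p2) K t x).
  apply/funext => t; rewrite /G fct_sumE; apply: eq_bigr => p1 _.
  by rewrite fct_sumE; apply: eq_bigr.
have Geta : ((normH H G)%:E <= eta H D N (xt m) (delta m))%E.
  by apply: ereal_sup_ubound; exists x => //; exists u => //; rewrite GE.
(* Finiteness of the product, part of [C_SOC], allows passing from extended reals to [fine]. *)
have Gt : normH H phi * normH H G <= fine (eta H D N (xt m) (delta m) * (normH H phi)%:E)%E.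
  rewrite -lee_fin fineK// mulrC EFinM lee_wpmul2r// lee_fin.
  exact: normH_ge0.
(* The diagonal term does not depend on the point and cancels. *)
have diffE : dotv u (affine_mx D f0 b0 Gamma f b (xt m) *m u) -
    dotv u (affine_mx D f0 b0 Gamma f b x *m u) = ip H phi G.
  rewrite quad_formB [RHS]ip_sumr//; apply: eq_bigr => p1 _.
  rewrite ip_sumr//; last by move=> p2; exact: carrierZ.
  apply: eq_bigr => p2 _; rewrite ipZr//; congr (_ * _).
  rewrite ipBr//; [|exact: (appQ_representer H hKs hK _ _ hX).1..].
  have affE y : affine_mx D f0 b0 Gamma f b y p1 p2 =
      diag_mx (Gamma *m b - b0)^T p1 p2 + ip H phi (fun t => appK (D p1 p2) K t y).
    rewrite [LHS]mxE addrC; congr (_ + _).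
    by rewrite -((appQ_representer H hKs hK (D p1 p2) y hX).2 phi cphi); exact: mxE.
  set c := diag_mx _ _ _ in affE.
  rewrite -[RHS](addrKA c) [ip H phi _ + c]addrC; congr (_ - _); exact: affE.
(* At a unit vector the constraint says that the form at the centre is at least eta times the norm
   of [phi], which dominates [ip H phi G]. *)
have := Hm u; rewrite quad_formB_scalar dotv_usphere// mulr1 subr_ge0 => tle.
have -> : dotv u (affine_mx D f0 b0 Gamma f b x *m u) =
    dotv u (affine_mx D f0 b0 Gamma f b (xt m) *m u) - ip H phi G.
  by rewrite -diffE opprB addrC subrK.
rewrite subr_ge0; apply: le_trans tle; apply: le_trans Gt.
exact: le_trans (ler_norm _) (ip_le_normH cphi cG).
Qed.
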